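(* Let $p\ge5$ be prime and $A,B\in\mathbb{N}$, put $f(x)=x^3+Ax+B$ and $\Delta=4A^3+27B^2$. Suppose $p\mid\Delta$ and $p\nmid A$, and let $m=v_p(\Delta)\in\{1,2,\dots\}\cup\{\infty\}$ and $\eta=\left(\frac{-2AB}{p}\right)\in\{\pm1\}$. Let $\rho\in\mathbb{F}_p$ be the unique repeated root of $f$ modulo $p$, and for $k\ge1$ let $M_k$ be the number of $(x,y)\in(\mathbb{Z}/p^k\mathbb{Z})^2$ with $y^2=f(x)$ in $\mathbb{Z}/p^k\mathbb{Z}$ and $(x,y)\equiv(\rho,0)\pmod p$. Then for every $k\ge1$, \[ \eta=+1:\qquad M_k=\begin{cases} p^{\,k-1}\bigl((k-1)p-(k-2)\bigr), & k\le m,\\ p^{\,k-1}(m-1)(p-1), & k>m;\end{cases} \] \[ \eta=-1:\qquad M_k=\begin{cases} p^{\,2\lfloor k/2\rfloor}, & k\le m,\\ 0, & k>m,\ m\text{ odd},\\ p^{\,k-1}(p+1), & k>m,\ m\text{ even}.\end{cases} \]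
   Context: $\mathbb{N}$ includes $0$. $v_p$ is the $p$-adic valuation with $v_p(0)=\infty$; when $m=\infty$ the case $k\le m$ always applies. $\left(\frac{\cdot}{p}\right)$ is the Legendre symbol. Under the hypotheses, $f$ modulo $p$ has exactly one repeated root $\rho=-3B/(2A)\in\mathbb{F}_p$, it is a nonzero double root, and $(\rho,0)$ is the unique singular point (a node) of the reduced curve $y^2=f(x)$ over $\mathbb{F}_p$. *)

(* Defs.v *)
From mathcomp Require Import all_boot all_order all_algebra.
From mathcomp Require Import ring.

Set Implicit Arguments.
Unset Strict Implicit.
Unset Printing Implicit Defensive.

Import Order.TTheory GRing.Theory Num.Theory.
Local Open Scope ring_scope.

Definition cubic (R : comNzRingType) (A B : nat) : {poly R} :=
  'X^3 + A%:R *: 'X + (B%:R)%:P.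

(* With natural A and B no sign or truncation issue arises, so this lives in
   nat. *)
Definition disc (A B : nat) : nat := (4 * A ^ 3 + 27 * B ^ 2)%N.

(* The p-adic valuation with values in nat extended by infinity, which is
   represented by None; [logn p 0 = 0] is thereby never used for v_p(0). *)
Definition vp (p n : nat) : option nat :=
  if n == 0%N then None else Some (logn p n).

Definition le_ext (k : nat) (m : option nat) : bool :=
  if m is Some m' then (k <= m')%N else true.

(* The Legendre symbol; meaningful for an odd prime p, for which 'F_p is the
   field of integers modulo p. *)
Definition legendre (p : nat) (a : int) : int :=
  if (a%:~R : 'F_p) == 0 then 0
  else if [exists x : 'F_p, x ^+ 2 == a%:~R] then 1 else -1.

Definition repeated_root (F : fieldType) (q : {poly F}) (r : F) : bool :=
  (1 < mup r q)%N.

(* Reduction Z/p^k -> F_p; 'Z_(p ^ k) is the ring Z/p^k as soon as p ^ k > 1. *)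
Definition red (p k : nat) (x : 'Z_(p ^ k)) : 'F_p := (x : nat)%:R.

Definition node_count (p A B : nat) (rho : 'F_p) (k : nat) : nat :=
  #|[set xy : 'Z_(p ^ k) * 'Z_(p ^ k) |
      [&& xy.2 ^+ 2 == (cubic 'Z_(p ^ k) A B).[xy.1],
          red xy.1 == rho & red xy.2 == 0]]|.

Lemma Fp_nat_eq0 (p n : nat) : prime p -> ((n%:R : 'F_p) == 0) = (p %| n)%N.
Proof. by move=> pp; rewrite (dvdn_pcharf (pchar_Fp pp)). Qed.

Lemma cubic_neq0 (F : fieldType) (A B : nat) : cubic F A B != 0.
Proof.
apply/eqP => /(congr1 (fun q : {poly F} => q`_3)).
rewrite /cubic !coefE /= mulr0 !addr0.
by move/eqP; rewrite oner_eq0.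
Qed.

Lemma repeated_root_cubic (F : fieldType) (A B : nat) (r : F) :
  repeated_root (cubic F A B) r =
  (r ^+ 3 + A%:R * r + B%:R == 0) && (3 * r ^+ 2 + A%:R == 0).
Proof.
have fE : cubic F A B = ('X + (2 * r)%:P) * ('X - r%:P) ^+ 2
   + ((3 * r ^+ 2 + A%:R)%:P * ('X - r%:P)
      + (r ^+ 3 + A%:R * r + B%:R)%:P).
  by rewrite /cubic -mul_polyC; ring.
rewrite /repeated_root mup_geq ?cubic_neq0 // fE.
rewrite dvdp_addr; last exact: dvdp_mulIr.
apply/idP/andP => [dv | [/eqP-> /eqP->]]; last first.
  by rewrite !polyC0 mul0r addr0 dvdp0.
set a := 3 * _ + _ in dv *; set c := _ + B%:R in dv *.
have /eqP h : a%:P * ('X - r%:P) + c%:P == 0.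
  apply: contraLR dv => nz; apply/negP => /(dvdp_leq nz).
  rewrite size_exp_XsubC leqNgt => /negP; apply.
  rewrite ltnS mul_polyC.
  apply: leq_trans (size_polyD _ _) _.
  rewrite geq_max (leq_trans (size_scale_leq _ _)) ?size_XsubC //.
  by rewrite (leq_trans (size_polyC_leq1 _)).
have c0 : c = 0.
  move/(congr1 (horner^~ r)): (h).
  by rewrite hornerD hornerM hornerXsubC !hornerC subrr mulr0 add0r.
split; first by rewrite c0.
move/eqP: h; rewrite c0 polyC0 addr0 mulf_eq0 polyXsubC_eq0 orbF.
by rewrite polyC_eq0.
Qed.

(* This justifies speaking of the repeated root of f modulo p: any rho with
   [repeated_root (cubic 'F_p A B) rho] is the unique one. *)
Lemma repeated_root_exists_unique (p A B : nat) :
  prime p -> (5 <= p)%N -> (p %| disc A B)%N -> ~~ (p %| A)%N ->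
  exists! rho : 'F_p, repeated_root (cubic 'F_p A B) rho.
Proof.
move=> pp p5 pD pA.
have a0 : (A%:R : 'F_p) != 0 by rewrite Fp_nat_eq0.
have n2 : (2 : 'F_p) != 0.
  by rewrite Fp_nat_eq0 // gtnNdvd // (leq_trans _ p5).
have D0 : 4 * A%:R ^+ 3 + 27 * B%:R ^+ 2 = 0 :> 'F_p.
  apply/eqP; move: pD.
  by rewrite -Fp_nat_eq0 // natrD (natrM _ 4) (natrM _ 27) !natrX.
have a2 : 2 * A%:R != 0 :> 'F_p by rewrite mulf_neq0.
exists (- 3 * B%:R / (2 * A%:R)); split.
  rewrite repeated_root_cubic; apply/andP; split; apply/eqP.
    apply: (mulIf (expf_neq0 3 a2)); rewrite mul0r.
    transitivity (- B%:R * (4 * A%:R ^+ 3 + 27 * B%:R ^+ 2) : 'F_p).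
      by field; rewrite a0 n2.
    by rewrite D0 mulr0.
  apply: (mulIf (expf_neq0 2 a2)); rewrite mul0r -D0.
  by field; rewrite a0 n2.
move=> r; rewrite repeated_root_cubic => /andP[/eqP f0 /eqP f'0].
apply: (mulIf a2); rewrite divfK //.
have : 3 * (r ^+ 3 + A%:R * r + B%:R) - r * (3 * r ^+ 2 + A%:R) = 0.
  by rewrite f0 f'0 !mulr0 subr0.
move=> h; apply/eqP; rewrite eq_sym -subr_eq0 -h; apply/eqP; ring.
Qed.

Lemma legendre_eta (p A B : nat) :
  prime p -> (5 <= p)%N -> (p %| disc A B)%N -> ~~ (p %| A)%N ->
  let eta := legendre p (- 2%:Z * A%:Z * B%:Z) in eta = 1 \/ eta = -1.
Proof.
move=> pp p5 pD pA /=; rewrite /legendre.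
case: ifP => [|_]; last by case: ifP => _; [left | right].
have n2 : ~~ (p %| 2)%N by rewrite gtnNdvd // (leq_trans _ p5).
rewrite !rmorphM rmorphN /= !mulf_eq0 oppr_eq0 -!pmulrn !Fp_nat_eq0 //.
rewrite (negPf n2) (negPf pA) /= => pB; case/negP: pA.
have pB2 : (p %| 27 * B ^ 2)%N by rewrite dvdn_mull // dvdn_exp.
have n4 : ~~ (p %| 4)%N by rewrite gtnNdvd // (leq_trans _ p5).
by move: pD; rewrite /disc dvdn_addl // Euclid_dvdM // (negPf n4) Euclid_dvdX // => /andP[].
Qed.

(* Main.v *)
(** Let [s] in Z/p^k be the lift of [rho] with [f'(s) = 0]. Then
    [f(s + u) = c + 3 s u^2 + u^3] with [c = f(s)], and [c] is a unit times the
    discriminant, so one counts the solutions of [y^2 - 3 s u^2 - u^3 = c] with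
    [u] and [y] divisible by [p]. Sort them by the largest [j] such that [p^j]
    divides both: writing [(u, y) = p^j (u', y')] the equation becomes
    [p^(2j) (y'^2 - 3 s u'^2 - p^j u'^3) = c] with [(u', y')] primitive, and by
    Hensel the primitive solutions of [y'^2 - 3 s u'^2 - p^j u'^3 = t] number
    p^(k-1) times the nonzero points of the conic [y^2 - 3 rho u^2 = t] over
    F_p. The sign [eta] says whether [3 rho], which is [-2AB] up to a square, is
    a square. *)
Require Import Defs.
From mathcomp Require Import all_boot all_order all_algebra.
From mathcomp Require Import ring zify.

Set Implicit Arguments.
Unset Strict Implicit.
Unset Printing Implicit Defensive.

Import Order.TTheory GRing.Theory Num.Theory.
Local Open Scope ring_scope.

(** * Parity arithmetic and counting by fibres *)

Lemma posz_odd_uphalf (n : nat) : odd n ->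
  n%:Z = (uphalf n - 1)%N%:Z * 2 + 1.
Proof. by lia. Qed.

Lemma posz_even_uphalf (n : nat) : (0 < n)%N -> ~~ odd n ->
  n%:Z = (uphalf n - 1)%N%:Z * 2 + 2.
Proof. by lia. Qed.

Lemma double_div2_odd (n : nat) : odd n -> (2 * (n %/ 2) = n - 1)%N.
Proof. by lia. Qed.

Lemma double_div2_even (n : nat) : (0 < n)%N -> ~~ odd n ->
  (2 * (n %/ 2) = (n - 1).+1)%N.
Proof. by lia. Qed.

Lemma card_uniform_fibres (T U : finType) (f : T -> U) (A : {set T})
    (B : {set U}) (n : nat) :
  {in A, forall x, f x \in B} ->
  {in B, forall y, #|[set x in A | f x == y]| = n} ->
  #|A| = (#|B| * n)%N.
Proof.
move=> fAB fib; rewrite -sum1_card (partition_big f (mem B)) //=.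
rewrite -sum_nat_const; apply: eq_bigr => y By.
by rewrite -(fib y By) -sum1_card; apply: eq_bigl => x; rewrite inE.
Qed.

(** * Conics [y^2 - e u^2 = t] over a finite field of odd characteristic *)

Section Conic.

Variable F : finFieldType.
Hypothesis two_neq0 : (2 : F) != 0.

(** Vectors are [(u, y)]. Leaving out the origin matters only for [t = 0]; it mirrors the
    primitivity of solutions modulo [p^k]. *)
Definition conic (e t : F) : {set F * F} :=
  [set v | (v != (0, 0)) && (v.2 ^+ 2 - e * v.1 ^+ 2 == t)].

(** The conic degenerates to the lines [y = r u] and [y = - r u], which are distinct because
    [2 r != 0]. *)
Lemma card_conic0_square (r : F) : r != 0 -> #|conic (r ^+ 2) 0| = (#|F|.-1 * 2)%N.
Proof.
move=> r0; rewrite -(cardsC1 (0 : F)).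
apply: (@card_uniform_fibres _ _ (fun v => v.1)) => [[u y]|u]; rewrite !inE /=.
  rewrite xpair_eqE; case: (eqVneq u 0) => [->|//]; rewrite expr0n mulr0 subr0 sqrf_eq0 => /andP[+ /eqP y0].
  by rewrite y0 eqxx.
move=> u0; transitivity #|[set (u, r * u); (u, - (r * u))]|; last first.
  rewrite cards2 xpair_eqE eqxx /= -addr_eq0 -mulr2n -mulr_natl.
  by rewrite !mulf_neq0.
apply: eq_card => [[x y]]; rewrite !inE !xpair_eqE /=.
case: (eqVneq x u) => [->|]; last by rewrite andbF.
by rewrite (negPf u0) andbT /= -exprMn subr_eq0 eqf_sqr.
Qed.

Lemma conic0_nonsquare (e : F) : ~~ [exists x, x ^+ 2 == e] -> conic e 0 = set0.
Proof.
move=> ns; apply/setP => [[u y]]; rewrite !inE xpair_eqE subr_eq0 /=.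
apply/negP => /andP[+ /eqP yu]; have [u0|u0] := eqVneq u 0.
  by move/eqP: yu; rewrite u0 expr0n mulr0 sqrf_eq0 => ->.
case/negP: ns; apply/existsP; exists (y / u).
by rewrite exprMn yu exprVn mulfK // sqrf_eq0.
Qed.

(** Squaring is at most two to one, and one to one over [0]. The fibre over [0] makes the inequality
    strict, which the pigeonhole argument below needs. *)
Lemma card_sqr_image : (#|F| < 2 * #|[set x ^+ 2 | x : F]|)%N.
Proof.
set S := [set _ | _ in _].
have S0 : 0 \in S by apply/imsetP; exists 0; rewrite ?expr0n.
rewrite -[X in (X < _)%N]sum1_card (partition_big (fun x => x ^+ 2) (mem S)) /=; last first.
  by move=> x _; apply: imset_f.
rewrite (bigD1 0) //= mulnC (cardsD1 0 S) S0 mulnDl -addSn leq_add //.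
  rewrite sum1_card (@eq_card1 _ 0) // => x.
  by rewrite -[LHS]/(x ^+ 2 == 0) sqrf_eq0 inE.
rewrite -sum_nat_const.
rewrite (eq_bigl (fun i => i \in S :\ 0)); last by move=> i; rewrite !inE andbC.
apply: leq_sum => s; rewrite !inE => /andP[_ /imsetP[x _ ->]].
rewrite sum1_card; apply: leq_trans (_ : #|[set x; - x]| <= 2)%N.
  by apply: subset_leq_card; apply/subsetP => y; rewrite !inE -eqf_sqr.
by rewrite cards2; case: eqP.
Qed.

(** The values [y^2] and the values [t + e u^2] each fill more than half of the field, so the two
    sets meet. *)
Lemma conic_neq0 (e t : F) : e != 0 -> t != 0 -> conic e t != set0.
Proof.
move=> e0 t0; pose S := [set x ^+ 2 | x : F].
pose g (s : F) := t + e * s.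
have injg : injective g by move=> x y /addrI /(mulfI e0).
have : [exists y, (y \in S) && (y \in g @: S)].
  apply: contraT; rewrite negb_exists => /forallP dis.
  have : (#|S :|: g @: S| <= #|F|)%N by rewrite max_card.
  rewrite cardsU (_ : _ :&: _ = set0); last first.
    by apply/setP => y; rewrite [LHS]inE in_set0; apply: negbTE.
  rewrite cards0 (card_imset _ injg) subn0.
  by have := card_sqr_image; rewrite -/S; lia.
case/existsP => _ /andP[/imsetP[y _ ->] /imsetP[_ /imsetP[u _ ->] yu]].
apply/set0Pn; exists (u, y); rewrite inE /= yu /g addrK eqxx andbT.
apply: contra_neq t0 => -[u0 y0]; move: yu.
by rewrite /g u0 y0 expr0n mulr0 addr0.
Qed.

(** The form [y^2 - e u^2] is the norm from [F[X]/(X^2 - e)], hence multiplicative, and an element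
    of norm [t / s] carries one conic into the other. Exchanging [s] and [t] gives equality. *)
Lemma leq_card_conic (e s t : F) : e != 0 -> s != 0 -> t != 0 ->
  (#|conic e s| <= #|conic e t|)%N.
Proof.
move=> e0 s0 t0.
have /set0Pn[[b a]] := conic_neq0 e0 (mulf_neq0 t0 (invr_neq0 s0)).
rewrite inE /= => /andP[_ /eqP nab].
(* multiplication by [a + b sqrt e] in [F(sqrt e)] *)
pose h (v : F * F) := (a * v.1 + b * v.2, a * v.2 + e * b * v.1).
have ts0 : a ^+ 2 - e * b ^+ 2 != 0 by rewrite nab mulf_neq0 ?invr_neq0.
have h_inj : injective h.
  move=> [u y] [u' y'] [h1 h2]; congr (_, _); apply: (mulfI ts0).
    transitivity (a * (a * u + b * y) - b * (a * y + e * b * u)); first by ring.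
    by rewrite h1 h2; ring.
  transitivity (a * (a * y + e * b * u) - e * b * (a * u + b * y)); first by ring.
  by rewrite h1 h2; ring.
rewrite -(card_imset _ h_inj); apply: subset_leq_card.
apply/subsetP => _ /imsetP[[u y] + ->]; rewrite !inE /= => /andP[_ /eqP nuy].
have eq_t : (a * y + e * b * u) ^+ 2 - e * (a * u + b * y) ^+ 2 = t.
  transitivity ((a ^+ 2 - e * b ^+ 2) * (y ^+ 2 - e * u ^+ 2)); first by ring.
  by rewrite nab nuy divfK.
rewrite eq_t eqxx andbT; apply: contra_neq t0 => -[h1 h2].
by rewrite -eq_t h1 h2 expr0n mulr0 subr0.
Qed.

(** Sort the nonzero vectors by their value under the form: all nonzero values are taken equally
    often. The count for [t != 0] thus follows from the count for [0]. *)
Lemma card_conic_total (e t : F) : e != 0 -> t != 0 ->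
  (#|F|.-1 * #|conic e t| + #|conic e 0%R| = #|F| ^ 2 - 1)%N.
Proof.
move=> e0 t0.
have -> : (#|F| ^ 2 - 1 = #|[set~ ((0, 0)%R : F * F)]|)%N.
  by rewrite cardsC1 card_prod subn1.
rewrite -(cardsID (conic e 0) [set~ _]) addnC; congr (_ + _)%N.
  by apply: eq_card => v; rewrite !inE; case: (v == _).
rewrite -(cardsC1 (0 : F)); symmetry.
apply: (@card_uniform_fibres _ _ (fun v => v.2 ^+ 2 - e * v.1 ^+ 2)) => [v|s].
  by rewrite !inE; case: (v == _); rewrite ?andbF ?andbT.
rewrite !inE => s0.
transitivity #|conic e s|; last by apply/eqP; rewrite eqn_leq !leq_card_conic.
apply: eq_card => v; rewrite !inE; case: (v == _) => /=; rewrite ?andbT //.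
by case: eqVneq => //= ->; rewrite eq_sym (negPf s0).
Qed.

End Conic.

(** * Reduction modulo [p], divisibility by powers of [p] and Hensel lifting in [Z/p^k] *)

Section PrimePowerRing.

Variables (p k : nat).
Hypotheses (p_prime : prime p) (k_gt0 : (0 < k)%N).

Local Notation R := 'Z_(p ^ k).

Lemma expn_gt1 : (1 < p ^ k)%N.
Proof. by rewrite -(exp1n k) ltn_exp2r // prime_gt1. Qed.
Local Hint Resolve expn_gt1 : core.

Lemma red_nat n : red (n%:R : R) = n%:R.
Proof.
rewrite /red val_Zp_nat // [in RHS](divn_eq n (p ^ k)) natrD natrM natrX.
by rewrite pchar_Fp_0 // expr0n (gtn_eqF k_gt0) mulr0 add0r.
Qed.

Lemma redD (x y : R) : red (x + y) = red x + red y.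
Proof. by rewrite -(natr_Zp x) -(natr_Zp y) -natrD !red_nat natrD. Qed.

Lemma redM (x y : R) : red (x * y) = red x * red y.
Proof. by rewrite -(natr_Zp x) -(natr_Zp y) -natrM !red_nat natrM. Qed.

Lemma redN (x : R) : red (- x) = - red x.
Proof.
by apply/eqP; rewrite -addr_eq0 -redD addNr (red_nat 0).
Qed.

Lemma redX (x : R) n : red (x ^+ n) = red x ^+ n.
Proof. by elim: n => [|n IH]; rewrite ?(red_nat 1) // !exprS redM IH. Qed.

Definition redE := (redD, redN, redM, redX, red_nat).

Lemma red_eq0 (x : R) : (red x == 0) = (p %| (x : nat))%N.
Proof. by rewrite Fp_nat_eq0. Qed.

Lemma red_unit (x : R) : red x != 0 -> x \is a GRing.unit.
Proof.
rewrite red_eq0 -[X in X \is a _]natr_Zp unitZpE // => px.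
by rewrite coprimeXl // prime_coprime.
Qed.

(* [p ^ j] divides [x] in [R]; meaningful for [j <= k] only. *)
Definition pdvd j (x : R) := (p ^ j %| (x : nat))%N.

Lemma pdvd_nat j n : (j <= k)%N -> pdvd j (n%:R : R) = (p ^ j %| n)%N.
Proof.
move=> jk; rewrite /pdvd val_Zp_nat // [in RHS](divn_eq n (p ^ k)).
by rewrite dvdn_addr // dvdn_mull // dvdn_exp2l.
Qed.

Lemma pdvd1 (x : R) : pdvd 1 x = (red x == 0).
Proof. by rewrite red_eq0. Qed.

Lemma pdvdP j (x : R) : (j <= k)%N ->
  reflect (exists y, x = (p ^ j)%:R * y) (pdvd j x).
Proof.
move=> jk; apply: (iffP idP) => [/dvdnP[y xy]|[y ->]].
  by exists y%:R; rewrite -[LHS]natr_Zp xy mulnC natrM.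
by rewrite -(natr_Zp y) -natrM pdvd_nat // dvdn_mulr.
Qed.

Lemma pdvd_mul j i (x : R) : (i + j <= k)%N ->
  pdvd (j + i) ((p ^ j)%:R * x) = pdvd i x.
Proof.
move=> ijk; rewrite -[X in _ * X]natr_Zp -natrM pdvd_nat; last by rewrite addnC.
by rewrite expnD dvdn_pmul2l // expn_gt0 prime_gt0.
Qed.

Lemma pmul_eq0 j (x : R) : (j <= k)%N -> ((p ^ j)%:R * x == 0) = pdvd (k - j) x.
Proof.
move=> jk; rewrite -(pdvd_mul (j := j)) ?subnK // subnKC //.
apply/eqP/idP => [->|/(pdvdP _ (leqnn k))[y ->]]; first by rewrite /pdvd dvdn0.
by rewrite pchar_Zp // mul0r.
Qed.

Lemma card_pdvd j : (j <= k)%N -> #|[set x | pdvd j x]| = (p ^ (k - j))%N.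
Proof.
move=> jk; pose f (i : 'I_(p ^ (k - j))) : R := (p ^ j * i)%:R.
have bnd (i : 'I_(p ^ (k - j))) : (p ^ j * i < p ^ k)%N.
  by rewrite -{2}(subnKC jk) expnD ltn_pmul2l ?expn_gt0 ?prime_gt0.
have f_inj : injective f.
  move=> i i' /(congr1 (fun x : R => x : nat)); rewrite !val_Zp_nat // !modn_small //.
  by move/eqP; rewrite eqn_pmul2l ?expn_gt0 ?prime_gt0 // => /eqP /val_inj.
rewrite -[RHS]card_ord -(card_imset _ f_inj); apply: eq_card => x.
rewrite inE; apply/idP/imsetP => [/dvdnP[y xy]|[i _ ->]]; last first.
  by rewrite /f pdvd_nat // dvdn_mulr.
have yb : (y < p ^ (k - j))%N.
  have : (x < p ^ k)%N by apply: leq_trans (ltn_ord x) _; rewrite Zp_cast.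
  by rewrite xy mulnC -{1}(subnKC jk) expnD ltn_pmul2l ?expn_gt0 ?prime_gt0.
by exists (Ordinal yb); rewrite // /f /= mulnC -xy natr_Zp.
Qed.

(** The fibre is a translate of the kernel of multiplication by [p^j], which consists of the
    multiples of [p^(k-j)]. *)
Lemma card_pmul_fibre j (v : R) : (j <= k)%N -> pdvd j v ->
  #|[set x | (p ^ j)%:R * x == v]| = (p ^ j)%N.
Proof.
move=> jk /(pdvdP _ jk)[y ->].
transitivity #|[set x | pdvd (k - j) x]|; last by rewrite card_pdvd ?subKn ?leq_subr.
rewrite -(card_imset _ (addrI y)); apply: eq_card => x.
rewrite inE -subr_eq0 -mulrBr pmul_eq0 //; apply/idP/imsetP => [h|[z + ->]].
  by exists (x - y); rewrite ?inE // [RHS]addrC subrK.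
by rewrite inE [y + z]addrC addrK.
Qed.

Lemma card_red_fibre (a : 'F_p) : #|[set x : R | red x == a]| = (p ^ (k - 1))%N.
Proof.
rewrite -card_pdvd // -[RHS](card_imset _ (addrI (a : nat)%:R)).
apply: eq_card => x; rewrite inE.
have ra : red ((a : nat)%:R : R) = a by rewrite red_nat natr_Zp.
apply/eqP/imsetP => [h|[z + ->]].
  exists (x - (a : nat)%:R); last by rewrite [RHS]addrC subrK.
  by rewrite inE pdvd1 !redE h natr_Zp subrr.
by rewrite inE pdvd1 redD ra => /eqP ->; rewrite addr0.
Qed.

(* Hensel's lemma: [g] is a divided difference of [h], so that [h] is injective
   on a residue class, hence onto the class of its values by cardinality. *)
Lemma card_hensel (h : R -> R) (g : R -> R -> R) (a : 'F_p) (t : R) :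
  (forall x y, h x - h y = (x - y) * g x y) ->
  (forall x y, red x = a -> red y = a -> red (g x y) != 0) ->
  (forall x, red x = a -> red (h x) = red t) ->
  #|[set x | (red x == a) && (h x == t)]| = 1%N.
Proof.
move=> hg gu ht; pose C b : {set R} := [set x | red x == b].
have h_inj : {in C a &, injective h}.
  move=> x y; rewrite !inE => /eqP xa /eqP ya hxy.
  apply/eqP; rewrite -subr_eq0; apply/eqP.
  by apply: (mulIr (red_unit (gu _ _ xa ya))); rewrite mul0r -hg hxy subrr.
have hC : h @: C a = C (red t).
  apply/eqP; rewrite eqEcard card_in_imset // !card_red_fibre leqnn andbT.
  by apply/subsetP => _ /imsetP[x + ->]; rewrite !inE => /eqP/ht ->.
have : t \in h @: C a by rewrite hC inE.
case/imsetP => x xa tx; apply/eqP/cards1P; exists x; apply/setP => y.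
rewrite !inE; apply/andP/eqP => [[ya /eqP hy]|->]; last first.
  by move: xa; rewrite inE tx eqxx.
by apply: h_inj; rewrite ?hy // inE.
Qed.

(** * Solutions of the local equation at the node, stratified by powers of [p] *)

Hypothesis p_odd : (2 < p)%N.

Lemma Fp_two_neq0 : (2 : 'F_p) != 0.
Proof. by rewrite Fp_nat_eq0 // gtnNdvd. Qed.

(** The coefficient [d] absorbs rescaling: [d = 1] is the equation at the node, and dividing both
    coordinates by [p^j] produces [d = p^j]. *)
Definition node_form (e d : R) (v : R * R) : R :=
  v.2 ^+ 2 - e * v.1 ^+ 2 - d * v.1 ^+ 3.

Definition primitive (v : R * R) : bool := ~~ (pdvd 1 v.1 && pdvd 1 v.2).

Lemma red_node_form e d v : red d = 0 ->
  red (node_form e d v) = red v.2 ^+ 2 - red e * red v.1 ^+ 2.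
Proof. by move=> d0; rewrite /node_form !redE d0 mul0r subr0. Qed.

Lemma card_primitive (e d t : R) : red e != 0 -> red d = 0 ->
  #|[set v | primitive v && (node_form e d v == t)]| =
  (#|conic (red e) (red t)| * p ^ (k - 1))%N.
Proof.
move=> e0 d0; have n2 := Fp_two_neq0.
apply: (@card_uniform_fibres _ _ (fun v => (red v.1, red v.2))) => [v|[u0 y0]].
  rewrite !inE /primitive !pdvd1 xpair_eqE /= => /andP[-> /eqP <-].
  by rewrite red_node_form ?eqxx.
rewrite inE /= xpair_eqE => /andP[uy0 /eqP nuy].
(* A nonzero point of the reduced conic has a nonzero partial derivative: [2 y0], or [- 2 e u0] when
   [y0 = 0]. The other coordinate is lifted freely, in [p^(k-1)] ways, and Hensel's lemma determines
   this one. *)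
have [y00|y00] := eqVneq y0 0.
  have u00 : u0 != 0 by move: uy0; rewrite y00 eqxx andbT.
  rewrite -(card_red_fibre (y0 : 'F_p)) -[RHS]muln1.
  apply: (@card_uniform_fibres _ _ (fun v => v.2)) => [v|y].
    by rewrite !inE xpair_eqE => /andP[_ /andP[]].
  rewrite inE => /eqP ry.
  pose h x := node_form e d (x, y).
  pose g x x' := - (e * (x + x') + d * (x ^+ 2 + x * x' + x' ^+ 2)).
  have inj_y : injective (fun x : R => (x, y)) by move=> x x' [].
  rewrite -(@card_hensel h g u0 t) => [||x x' rx rx'|x rx].
  - rewrite -[RHS](card_imset _ inj_y); apply: eq_card => [[x y']].
    rewrite !inE /primitive !pdvd1 xpair_eqE /=; apply/idP/imsetP.
      case/andP=> /andP[/andP[_ xt] /andP[xu _]] /eqP yy; exists x; rewrite -?yy //.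
      by rewrite inE xu /h -yy.
    case=> x'; rewrite inE => /andP[/eqP xu xt] [-> ->].
    by rewrite ry xu !eqxx (negPf u00) /= !andbT; apply: xt.
  - by move=> x x'; rewrite /h /g /node_form /=; ring.
  - rewrite /g !redE rx rx' d0 mul0r addr0 oppr_eq0 -mulr2n -mulr_natl.
    by rewrite !mulf_neq0.
  - by rewrite /h red_node_form //= rx ry nuy.
rewrite -(card_red_fibre (u0 : 'F_p)) -[RHS]muln1.
apply: (@card_uniform_fibres _ _ (fun v => v.1)) => [v|x].
  by rewrite !inE xpair_eqE => /andP[_ /andP[]].
rewrite inE => /eqP rx.
pose h y := node_form e d (x, y).
pose g (y y' : R) := y + y'.
have inj_x : injective (fun y : R => (x, y)) by move=> y y' [].
rewrite -(@card_hensel h g y0 t) => [||y y' ry ry'|y ry].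
- rewrite -[RHS](card_imset _ inj_x); apply: eq_card => [[x' y]].
  rewrite !inE /primitive !pdvd1 xpair_eqE /=; apply/idP/imsetP.
    case/andP=> /andP[/andP[_ xt] /andP[_ yu]] /eqP xx; exists y; rewrite -?xx //.
    by rewrite inE yu /h -xx.
  case=> y'; rewrite inE => /andP[/eqP yu yt] [-> ->].
  by rewrite rx yu !eqxx (negPf y00) andbF /= !andbT; apply: yt.
- by move=> y y'; rewrite /h /g /node_form /=; ring.
- by rewrite /g !redE ry ry' -mulr2n -mulr_natl mulf_neq0.
- by rewrite /h red_node_form //= rx ry nuy.
Qed.

Definition node_pts (e c : R) j : {set R * R} :=
  [set v | [&& pdvd j v.1, pdvd j v.2 & node_form e 1 v == c]].

Lemma node_form_scale e j v :
  node_form e 1 ((p ^ j)%:R * v.1, (p ^ j)%:R * v.2) =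
  (p ^ (2 * j))%:R * node_form e (p ^ j)%:R v.
Proof. by rewrite /node_form /= mul2n -addnn expnD natrM; ring. Qed.

(** If [p^j] divides both coordinates, the value of the form is a multiple of [p^(2j)], hence of
    [p^i]. *)
Lemma node_pts_set0 e c i j : (j <= k)%N -> (i <= k)%N -> (i <= 2 * j)%N ->
  ~~ pdvd i c -> node_pts e c j = set0.
Proof.
move=> jk ik ij; apply: contraNeq => /set0Pn[[x y]]; rewrite inE /= => /and3P[].
move=> /(pdvdP _ jk)[x' ->] /(pdvdP _ jk)[y' ->] /eqP <-.
rewrite (node_form_scale e j (x', y')); apply/pdvdP => //.
exists ((p ^ (2 * j - i))%:R * node_form e (p ^ j)%:R (x', y')).
by rewrite mulrA -natrM -expnD subnKC.
Qed.

(** Division by [p^j] is ambiguous in [Z/p^k], so the primitive [v] for which [p^j v] lies in the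
    stratum are counted in two ways, and the common factor [p^(2j)] is cancelled. *)
Lemma card_node_stratum e t j : red e != 0 -> (0 < j)%N -> (2 * j < k)%N ->
  let c := (p ^ (2 * j))%:R * t in
  #|node_pts e c j :\: node_pts e c j.+1| =
  (#|conic (red e) (red t)| * p ^ (k - 1))%N.
Proof.
move=> e0 j0 jk c; have jk' : (j < k)%N by lia.
pose X := [set v | primitive v && ((p ^ (2 * j))%:R * node_form e (p ^ j)%:R v == c)].
have c2 : pdvd (2 * j) c by apply/pdvdP; [lia|exists t].
(* First count: by the value of the rescaled form, which may be any of the [p^(2j)] solutions [t']
   of [p^(2j) t' = c]. *)
have X1 : #|X| = (p ^ (2 * j) * (#|conic (red e) (red t)| * p ^ (k - 1)))%N.
  rewrite -[in RHS](card_pmul_fibre (ltnW jk) c2).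
  apply: (@card_uniform_fibres _ _ (node_form e (p ^ j)%:R)) => [v|t'].
    by rewrite !inE => /andP[].
  rewrite inE => tt.
  (* The two differ by a multiple of [p^(k-2j)], and [2j < k]; so all admissible values give the
     same reduced conic. *)
  have -> : red t = red t'.
    apply/eqP; rewrite -subr_eq0 -redN -redD -pdvd1.
    have : pdvd (k - 2 * j) (t - t').
      by rewrite -pmul_eq0 ?(ltnW jk) // mulrBr (eqP tt) subrr.
    by apply: dvdn_trans; rewrite dvdn_exp2l //; lia.
  rewrite -(@card_primitive _ (p ^ j)%:R) //; last first.
    by rewrite red_nat natrX pchar_Fp_0 // expr0n (gtn_eqF j0).
  apply: eq_card => v; rewrite !inE -andbA; case: (primitive v) => //=.
  by case: (eqVneq (node_form _ _ v) t') => [->|]; rewrite ?tt ?andbF.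
(* Second count: each point of the stratum has [p^j] preimages per coordinate under multiplication
   by [p^j]. *)
have X2 : #|X| = (#|node_pts e c j :\: node_pts e c j.+1| * p ^ (2 * j))%N.
  pose f (v : R * R) := ((p ^ j)%:R * v.1, (p ^ j)%:R * v.2).
  have fj1 x : pdvd j.+1 ((p ^ j)%:R * x) = pdvd 1 x.
    by rewrite -addn1 pdvd_mul // add1n.
  have fj x : pdvd j ((p ^ j)%:R * x).
    by apply/pdvdP; [apply: ltnW|exists x].
  apply: (@card_uniform_fibres _ _ f) => [v|[a b]].
    rewrite !inE -node_form_scale /= !fj1 !fj /= => /andP[pv ->].
    by rewrite !andbT.
  rewrite !inE /= => /andP[nj1 /and3P[aj bj fc]].
  rewrite mul2n -addnn expnD.
  rewrite -[X in (X * _)%N](card_pmul_fibre (ltnW jk') aj).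
  rewrite -[X in (_ * X)%N](card_pmul_fibre (ltnW jk') bj).
  rewrite -cardsX; apply: eq_card => [[x y]]; rewrite !inE /= xpair_eqE /f /=.
  rewrite andbC; case: eqVneq => //= ax; case: eqVneq => //= by_.
  rewrite -node_form_scale /= ax by_ fc andbT /primitive /= -!fj1 ax by_.
  by move: nj1; rewrite fc andbT.
apply/eqP; rewrite -(eqn_pmul2r (m := p ^ (2 * j))) ?expn_gt0 ?prime_gt0 //.
by rewrite -X2 X1 mulnC.
Qed.

Lemma card_node_pts_sum e c h :
  #|node_pts e c 1| =
  (\sum_(1 <= j < h.+1) #|node_pts e c j :\: node_pts e c j.+1|
   + #|node_pts e c h.+1|)%N.
Proof.
elim: h => [|h ->]; first by rewrite big_geq.
rewrite [in RHS]big_nat_recr //= -addnA; congr (_ + _)%N.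
rewrite -(cardsID (node_pts e c h.+2)) addnC; congr (_ + _)%N.
apply: eq_card => v; rewrite !inE; apply: andb_idl => /and3P[av bv ->].
have sub x : pdvd h.+2 x -> pdvd h.+1 x by apply: dvdn_trans; rewrite dvdn_exp2l.
by rewrite !sub.
Qed.

(** The strata with [2j < k] contribute equally. From [j = uphalf k] on, the equation holds
    automatically because [2j >= k], so all pairs of multiples of [p^(uphalf k)] remain. *)
Lemma card_node_pts_zero e : red e != 0 ->
  #|node_pts e 0 1| =
  ((uphalf k - 1) * (#|conic (red e) 0%R| * p ^ (k - 1)) + p ^ (2 * (k %/ 2)))%N.
Proof.
move=> e0; rewrite (card_node_pts_sum _ _ (uphalf k).-1).
rewrite prednK ?uphalf_gt0 // -[in RHS]sum_nat_const_nat; congr (_ + _)%N.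
  apply: eq_big_nat => j /andP[j0 jk].
  have jk2 : (2 * j < k)%N by lia.
  by have := card_node_stratum 0 e0 j0 jk2; rewrite mulr0 (red_nat 0).
have uk : (uphalf k <= k)%N by lia.
have -> : (2 * (k %/ 2) = (k - uphalf k) + (k - uphalf k))%N by lia.
rewrite expnD -[in RHS](card_pdvd uk) -cardsX; apply: eq_card => [[x y]].
rewrite !inE /=; case: pdvdP => //= -[x' ->]; case: pdvdP => //= -[y' ->].
rewrite (node_form_scale e _ (x', y')) //.
rewrite (_ : (p ^ _)%:R = 0) ?mul0r //.
apply/eqP; rewrite -[_%:R]mulr1.
have -> : (2 * uphalf k = k + (2 * uphalf k - k))%N by lia.
by rewrite expnD natrM pchar_Zp // !mul0r.
Qed.

(** In stratum [j] the rescaled constant is [p^(n-2j) w]: it reduces to [0] while [2j < n] and to a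
    nonzero value when [2j = n], which requires [n] even. *)
Lemma card_node_pts_val e n w : red e != 0 -> red w != 0 -> (0 < n < k)%N ->
  #|node_pts e ((p ^ n)%:R * w) 1| =
  (((uphalf n - 1) * #|conic (red e) 0%R|
    + ~~ odd n * #|conic (red e) (red w)|) * p ^ (k - 1))%N.
Proof.
move=> e0 w0 /andP[n0 nk]; set c := _ * w.
have nc : ~~ pdvd n.+1 c by rewrite -addn1 pdvd_mul ?add1n // pdvd1.
(* Past [j = n./2] nothing is left: the form would be divisible by [p^(n+1)], unlike [c]. *)
rewrite (card_node_pts_sum _ _ n./2) (@node_pts_set0 _ _ n.+1) //; try lia.
rewrite cards0 addn0.
have stratum j : (0 < j)%N -> (2 * j <= n)%N ->
    #|node_pts e c j :\: node_pts e c j.+1| =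
    (#|conic (red e) (red ((p ^ (n - 2 * j))%:R * w)%R)| * p ^ (k - 1))%N.
  move=> j0 jn; rewrite -(card_node_stratum _ e0 j0) ?(leq_ltn_trans jn) //.
  by rewrite mulrA -natrM -expnD subnKC.
have below j : (0 < j)%N -> (2 * j < n)%N ->
    #|node_pts e c j :\: node_pts e c j.+1| =
    (#|conic (red e) 0%R| * p ^ (k - 1))%N.
  move=> j0 jn; rewrite stratum // 1?ltnW // redM red_nat natrX pchar_Fp_0 //.
  by rewrite expr0n subn_eq0 leqNgt jn mul0r.
have [n_odd|n_even] := boolP (odd n).
  rewrite mul0n addn0 -mulnA.
  rewrite (eq_big_nat _ _ (F2 := fun=> (#|conic (red e) 0%R| * p ^ (k - 1))%N)).
    by rewrite sum_nat_const_nat; congr (_ * _)%N; lia.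
  by move=> j /andP[j0 jn]; apply: below => //; lia.
rewrite big_nat_recr /=; last by lia.
rewrite stratum; [|lia|lia].
have -> : (n - 2 * n./2 = 0)%N by lia.
rewrite expn0 mul1r mul1n mulnDl; congr (_ + _)%N.
rewrite (eq_big_nat _ _ (F2 := fun=> (#|conic (red e) 0%R| * p ^ (k - 1))%N)).
  by rewrite sum_nat_const_nat -mulnA; congr (_ * _)%N; lia.
by move=> j /andP[j0 jn]; apply: below => //; lia.
Qed.

End PrimePowerRing.

(** * Split and nonsplit conics, and the Legendre symbol *)

Lemma card_conic_square (F : finFieldType) (r t : F) :
  (2 : F) != 0 -> r != 0 -> t != 0 -> #|conic (r ^+ 2) t| = #|F|.-1.
Proof.
move=> n2 r0 t0; have r20 : r ^+ 2 != 0 by rewrite sqrf_eq0.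
have := card_conic_total n2 r20 t0; rewrite card_conic0_square // => h.
(* Writing the order of the field as [q + 2] makes the factor [q + 1] visibly positive, so it can be
   cancelled. *)
move: h (card_finNzRing_gt1 F); move: #|conic _ _| #|F| => N [|[|q]] //= h _.
by apply/eqP; rewrite -(eqn_pmul2l (ltn0Sn q)); lia.
Qed.

Lemma card_conic_nonsquare (F : finFieldType) (e t : F) :
  (2 : F) != 0 -> ~~ [exists x, x ^+ 2 == e] -> t != 0 ->
  #|conic e t| = #|F|.+1.
Proof.
move=> n2 ns t0; have e0 : e != 0.
  by apply: contraNneq ns => ->; apply/existsP; exists 0; rewrite expr0n.
have := card_conic_total n2 e0 t0; rewrite conic0_nonsquare // cards0 => h.
move: h (card_finNzRing_gt1 F); move: #|conic _ _| #|F| => N [|[|q]] //= h _.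
by apply/eqP; rewrite -(eqn_pmul2l (ltn0Sn q)); lia.
Qed.

Lemma legendre_eq1 (p : nat) (a : int) : legendre p a = 1 ->
  exists2 x : 'F_p, x ^+ 2 = a%:~R & (a%:~R : 'F_p) != 0.
Proof.
rewrite /legendre; case: eqP => // /eqP a0.
by case: existsP => // -[x /eqP xa] _; exists x.
Qed.

Lemma legendre_eqN1 (p : nat) (a : int) : legendre p a = -1 ->
  ~~ [exists x : 'F_p, x ^+ 2 == a%:~R].
Proof. by rewrite /legendre; case: eqP => // _; case: ifP. Qed.

(** * The node of the cubic and its lift to [Z/p^k] *)

Section NodalFibre.

Variables (p A B k : nat) (rho : 'F_p).
Hypotheses (p_prime : prime p) (p_ge5 : (5 <= p)%N) (k_gt0 : (0 < k)%N).
Hypotheses (p_ndvd_A : ~~ (p %| A)%N).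
Hypothesis rho_def : repeated_root (cubic 'F_p A B) rho.

Local Notation R := 'Z_(p ^ k).

Let p_odd : (2 < p)%N. Proof. exact: leq_trans p_ge5. Qed.
Let A0 : (A%:R : 'F_p) != 0. Proof. by rewrite Fp_nat_eq0. Qed.
Let n2 : (2 : 'F_p) != 0. Proof. exact: Fp_two_neq0. Qed.
Let n3 : (3 : 'F_p) != 0.
Proof. by rewrite Fp_nat_eq0 // gtnNdvd // (leq_trans _ p_ge5). Qed.
Let f_rho : rho ^+ 3 + A%:R * rho + B%:R = 0.
Proof. by move: rho_def; rewrite repeated_root_cubic => /andP[/eqP]. Qed.
Let df_rho : 3 * rho ^+ 2 + A%:R = 0.
Proof. by move: rho_def; rewrite repeated_root_cubic => /andP[_ /eqP]. Qed.

Lemma repeated_root_neq0 : rho != 0.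
Proof.
by apply: contra_neq A0 => r0; rewrite -df_rho r0 expr0n mulr0 add0r.
Qed.

(** The combination [3 f - x f'] is the linear polynomial [2 A x + 3 B], and it vanishes at
    [rho]. *)
Lemma repeated_root_eq : 2 * A%:R * rho = - (3 * B%:R).
Proof.
apply/eqP; rewrite -addr_eq0; apply/eqP.
transitivity (3 * (rho ^+ 3 + A%:R * rho + B%:R) - rho * (3 * rho ^+ 2 + A%:R)).
  by ring.
by rewrite f_rho df_rho !mulr0 subr0.
Qed.

(** The tangents at the node are [y^2 = 3 rho u^2], and [3 rho = -9B/(2A)] is [-2AB] times the
    square of [3/(2A)]. *)
Lemma node_tangent_square (x : 'F_p) : x ^+ 2 = - 2 * A%:R * B%:R ->
  3 * rho = (3 * x / (2 * A%:R)) ^+ 2.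
Proof.
move=> xx; have a2 : 2 * A%:R != 0 :> 'F_p by rewrite mulf_neq0.
apply: (mulIf (expf_neq0 2 a2)); rewrite -exprMn divfK // [RHS]exprMn xx.
transitivity (3 * (2 * A%:R) * (2 * A%:R * rho)); first by ring.
by rewrite repeated_root_eq; ring.
Qed.

Lemma node_tangent_nonsquare :
  ~~ [exists x : 'F_p, x ^+ 2 == - 2 * A%:R * B%:R] ->
  ~~ [exists x : 'F_p, x ^+ 2 == 3 * rho].
Proof.
apply: contraNN => /existsP[y /eqP yy].
apply/existsP; exists (2 * A%:R * y / 3); apply/eqP.
apply: (mulIf (expf_neq0 2 n3)); rewrite -exprMn divfK // [LHS]exprMn yy.
transitivity (3 * (2 * A%:R) * (2 * A%:R * rho)); first by ring.
by rewrite repeated_root_eq; ring.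
Qed.

(** Hensel's lemma applies to [f'], since its derivative [6 rho] at [rho] is nonzero. Expanding [f]
    at the lift leaves no linear term. *)
Lemma lift_critical_point :
  exists2 s : R, red s = rho & 3 * s ^+ 2 + A%:R = 0.
Proof.
pose h (x : R) := 3 * x ^+ 2 + A%:R.
have : #|[set x | (red x == rho) && (h x == 0)]| = 1%N.
  apply: (@card_hensel p k p_prime k_gt0 h (fun x y => 3 * (x + y))).
  - by move=> x y; rewrite /h; ring.
  - move=> x y rx ry; rewrite !redE // rx ry -mulr2n -[rho *+ 2]mulr_natl.
    by rewrite !mulf_neq0 // repeated_root_neq0.
  - by move=> x rx; rewrite /h !redE // rx df_rho (red_nat p_prime k_gt0 0).
move/eqP/cards1P => [s /setP/(_ s)]; rewrite !inE eqxx => /andP[/eqP rs /eqP hs].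
by exists s.
Qed.

Lemma node_count_node_pts (s : R) : red s = rho -> 3 * s ^+ 2 + A%:R = 0 ->
  node_count A B rho k =
  #|node_pts (3 * s) (s ^+ 3 + A%:R * s + B%:R) 1|.
Proof.
move=> rs ds; pose f (v : R * R) := (s + v.1, v.2).
have f_inj : injective f by move=> [x y] [x' y'] /eqP; rewrite xpair_eqE => /andP[/eqP/addrI /= -> /eqP /= ->].
rewrite -(card_imset _ f_inj); apply: eq_card => [[x y]].
have fE u : (cubic R A B).[s + u] =
    s ^+ 3 + A%:R * s + B%:R + (3 * s) * u ^+ 2 + u ^+ 3.
  rewrite /cubic !hornerD hornerXn hornerZ hornerX hornerC.
  transitivity (s ^+ 3 + A%:R * s + B%:R + (3 * s) * u ^+ 2 + u ^+ 3
    + (3 * s ^+ 2 + A%:R) * u); first by ring.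
  by rewrite ds mul0r addr0.
have memE u : ((s + u, y) \in [set xy : R * R | [&& xy.2 ^+ 2 == (cubic R A B).[xy.1],
    red xy.1 == rho & red xy.2 == 0]]) =
    ((u, y) \in node_pts (3 * s) (s ^+ 3 + A%:R * s + B%:R) 1).
  have ru : (red (s + u) == rho) = (red u == 0).
    by rewrite redD // rs addrC -subr_eq0 addrK.
  rewrite !inE /= !pdvd1 // ru.
  rewrite andbC -andbA; congr [&& _, _ & _].
  rewrite fE /node_form /= mul1r -subr_eq0 -[RHS]subr_eq0; congr (_ == 0); ring.
apply/idP/imsetP => [xy|[[u y'] uy [-> yy']]].
  exists (x - s, y); last by rewrite /f /= addrC subrK.
  by rewrite -memE addrC subrK.
by rewrite -yy' -memE in uy.
Qed.

(* The product of the two critical values of the cubic, at [s] and [- s], is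
   [disc A B / 27], and the one at [- s] is a unit. *)
Lemma critical_value_disc (s : R) : red s = rho -> 3 * s ^+ 2 + A%:R = 0 ->
  (* The witness is [27 f(-s)]; modulo [p], [f(-rho) = 2B - f(rho) = 2B], and [B] is nonzero because
     [2 A rho = - 3B]. *)
  exists2 w : R, red w != 0 &
    (s ^+ 3 + A%:R * s + B%:R) * w = (disc A B)%:R.
Proof.
move=> rs ds; exists (27 * (B%:R - s ^+ 3 - A%:R * s)).
  have : (3 * B%:R : 'F_p) != 0.
    by rewrite -oppr_eq0 -repeated_root_eq !mulf_neq0 // repeated_root_neq0.
  rewrite mulf_eq0 negb_or => /andP[_ B0].
  rewrite !redE // rs.
  have -> : 27 * (B%:R - rho ^+ 3 - A%:R * rho) = 3 * 3 * (2 * (3 * B%:R)) :> 'F_p.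
    transitivity (27 * (2 * B%:R - (rho ^+ 3 + A%:R * rho + B%:R)) : 'F_p).
      by ring.
    by rewrite f_rho; ring.
  by rewrite !mulf_neq0.
rewrite /disc natrD (natrM _ 4) (natrM _ 27) !natrX.
have -> : A%:R = - (3 * s ^+ 2) by apply/eqP; rewrite -addr_eq0 addrC ds.
ring.
Qed.

Lemma node_count_disc0 : (p ^ k %| disc A B)%N ->
  node_count A B rho k =
  ((uphalf k - 1) * (#|conic (3 * rho)%R 0%R| * p ^ (k - 1)) + p ^ (2 * (k %/ 2)))%N.
Proof.
move=> pkD; have [s rs ds] := lift_critical_point.
have [w w0 cw] := critical_value_disc rs ds.
rewrite (node_count_node_pts rs ds).
have -> : s ^+ 3 + A%:R * s + B%:R = 0.
  apply: (mulIr (red_unit p_prime k_gt0 w0)); rewrite mul0r cw.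
  by case/dvdnP: pkD => q ->; rewrite natrM pchar_Zp ?mulr0 // expn_gt1.
have re : red (3 * s) = 3 * rho by rewrite redM // red_nat // rs.
by rewrite card_node_pts_zero // re // mulf_neq0 // repeated_root_neq0.
Qed.

(** The critical value is [p^n] times the unit [q / w]. The reduction [t] of that unit may stay
    unspecified, as the conic counts are the same for all nonzero [t]. *)
Lemma node_count_disc_val n q : disc A B = (p ^ n * q)%N -> ~~ (p %| q)%N ->
  (0 < n < k)%N ->
  exists2 t : 'F_p, t != 0 &
  node_count A B rho k =
  (((uphalf n - 1) * #|conic (3 * rho)%R 0%R|
    + ~~ odd n * #|conic (3 * rho)%R t|) * p ^ (k - 1))%N.
Proof.
move=> Dn pq nk; have [s rs ds] := lift_critical_point.
have [w w0 cw] := critical_value_disc rs ds.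
have wU := red_unit p_prime k_gt0 w0.
have cE : s ^+ 3 + A%:R * s + B%:R = (p ^ n)%:R * (q%:R / w).
  by apply: (mulIr wU); rewrite cw mulrA divrK // Dn natrM.
have t0 : red (q%:R / w) != 0.
  apply: contraNneq pq => t0; rewrite -Fp_nat_eq0 // -(red_nat p_prime k_gt0).
  by rewrite -[q%:R](divrK wU) redM // t0 mul0r.
exists (red (q%:R / w)) => //.
have re : red (3 * s) = 3 * rho by rewrite redM // red_nat // rs.
rewrite (node_count_node_pts rs ds) cE card_node_pts_val // re //.
by rewrite mulf_neq0 // repeated_root_neq0.
Qed.

End NodalFibre.

Theorem theorem11 (p A B : nat) (m : option nat) (eta : int) (rho : 'F_p)
  (p_prime : prime p) (p_ge5 : (5 <= p)%N)
  (p_dvd_disc : (p %| disc A B)%N) (p_ndvd_A : ~~ (p %| A)%N)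
  (m_def : m = vp p (disc A B))
  (eta_def : eta = legendre p (- 2%:Z * A%:Z * B%:Z))
  (rho_def : repeated_root (cubic 'F_p A B) rho)
  (k : nat) (k_ge1 : (1 <= k)%N) :
  (eta = 1 ->
     (le_ext k m ->
        (node_count A B rho k)%:Z
        = p%:Z ^+ (k - 1) * ((k%:Z - 1) * p%:Z - (k%:Z - 2%:Z)))
     /\ (forall n : nat, m = Some n -> (n < k)%N ->
        (node_count A B rho k)%:Z
        = p%:Z ^+ (k - 1) * (n%:Z - 1) * (p%:Z - 1)))
  /\
  (eta = -1 ->
     (le_ext k m -> node_count A B rho k = (p ^ (2 * (k %/ 2)))%N)
     /\ (forall n : nat, m = Some n -> (n < k)%N -> odd n ->
        node_count A B rho k = 0%N)
     /\ (forall n : nat, m = Some n -> (n < k)%N -> ~~ odd n ->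
        node_count A B rho k = (p ^ (k - 1) * (p + 1))%N)).
Proof.
have p_odd : (2 < p)%N by apply: leq_trans p_ge5.
have n2 := Fp_two_neq0 p_prime p_odd.
have rho0 := repeated_root_neq0 p_prime p_ndvd_A rho_def.
have n3 : (3 : 'F_p) != 0 by rewrite Fp_nat_eq0 // gtnNdvd // (leq_trans _ p_ge5).
have cast_eta : (- 2%:Z * A%:Z * B%:Z)%:~R = - 2 * A%:R * B%:R :> 'F_p.
  by rewrite !rmorphM rmorphN /= -!pmulrn.
have pX j : p%:Z ^+ j = (p ^ j)%N%:Z by rewrite -!natz natrX.
have [p' pE] : exists p', p = p'.+1 by exists p.-1; rewrite prednK ?prime_gt0.
have cardF := card_Fp p_prime.
(* A zero discriminant is divisible by every [p^k], so infinite [m] joins the case [k <= m]. *)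
have le_case : le_ext k m -> (p ^ k %| disc A B)%N.
  rewrite m_def /vp; case: eqP => [->|/eqP D0] /=; first by rewrite dvdn0.
  by rewrite pfactor_dvdn // lt0n.
have gt_case n : m = Some n -> exists2 q, disc A B = (p ^ n * q)%N &
    ~~ (p %| q)%N /\ (0 < n)%N.
  rewrite m_def /vp; case: eqP => // /eqP; rewrite -lt0n => D0 [<-].
  have [q cq Dq] := pfactor_coprime p_prime D0.
  exists q; first by rewrite mulnC.
  by rewrite -prime_coprime // cq logn_gt0 mem_primes p_prime D0.
split=> eta1.
  have [x xx a0] := legendre_eq1 (etrans (esym eta_def) eta1).
  rewrite cast_eta in xx.
  have rE := node_tangent_square p_prime p_ge5 p_ndvd_A rho_def xx.
  set r := 3 * x / _ in rE.
  have r0 : r != 0 by rewrite -sqrf_eq0 -rE mulf_neq0.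
  have c0 := card_conic0_square n2 r0; rewrite -rE cardF in c0.
  split=> [/le_case pk|n /gt_case[q Dq [pq n0]] nk].
    rewrite (node_count_disc0 p_prime p_ge5 k_ge1 p_ndvd_A rho_def pk) c0.
    rewrite pX pE /=.
    (* With the factor [p^(k-1)] removed, the count is [(k-1)(p-1) + 1] for odd [k] and
       [(k-2)(p-1) + p] for even [k]; these agree. *)
    have [k_odd|k_even] := boolP (odd k).
      rewrite double_div2_odd // (posz_odd_uphalf k_odd).
      by rewrite !(PoszD, PoszM) -[p'.+1]addn1 !PoszD; ring.
    rewrite double_div2_even // expnS (posz_even_uphalf k_ge1 k_even).
    by rewrite !(PoszD, PoszM) -[p'.+1]addn1 !PoszD; ring.
  have nk' : (0 < n < k)%N by rewrite n0.
  have [t t0 ->] :=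
    node_count_disc_val p_prime p_ge5 k_ge1 p_ndvd_A rho_def Dq pq nk'.
  have c1 := card_conic_square n2 r0 t0; rewrite -rE cardF in c1.
  rewrite c0 c1 pX pE /=.
  (* For even [n] the lower strata give [(n-2)(p-1)] and the stratum [2j = n] supplies the missing
     [p-1]. *)
  have [n_odd|n_even] := boolP (odd n).
    by rewrite mul0n (posz_odd_uphalf n_odd) !(PoszD, PoszM) -[p'.+1]addn1 !PoszD; ring.
  by rewrite mul1n (posz_even_uphalf n0 n_even) !(PoszD, PoszM) -[p'.+1]addn1 !PoszD; ring.
have ns := legendre_eqN1 (etrans (esym eta_def) eta1).
rewrite cast_eta in ns.
have {}ns := node_tangent_nonsquare p_prime p_ge5 rho_def ns.
(* With irrational tangents all strata reducing to [t = 0] are empty; only the automatic solutions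
   or the stratum [2j = n] survive. *)
have c0 : #|conic (3 * rho) 0| = 0%N by rewrite conic0_nonsquare ?cards0.
split=> [/le_case pk|].
  rewrite (node_count_disc0 p_prime p_ge5 k_ge1 p_ndvd_A rho_def pk) c0.
  by rewrite mul0n muln0.
split=> n /gt_case[q Dq [pq n0]] nk n_odd;
  have nk' : (0 < n < k)%N by rewrite n0.
  have [t t0 ->] :=
    node_count_disc_val p_prime p_ge5 k_ge1 p_ndvd_A rho_def Dq pq nk'.
  by rewrite c0 n_odd muln0 mul0n.
have [t t0 ->] :=
  node_count_disc_val p_prime p_ge5 k_ge1 p_ndvd_A rho_def Dq pq nk'.
rewrite c0 n_odd muln0 mul1n (card_conic_nonsquare n2 ns t0) cardF.
by rewrite mulnC addn1.
Qed.
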